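(* Let $x$ be a positive real number. The following bound is satisfied: $$\pi(x) \geq \frac{\lfloor \lg x \rfloor}{\lg (\lfloor \lg x \rfloor + 1)}.$$
   Context: Here $\pi(x)$ denotes the prime counting function, i.e. the number of primes in $\{1, 2, \dots, \lfloor x \rfloor\}$; $\lg$ denotes the base $2$ logarithm; and $\lfloor y \rfloor$ denotes the integer part (floor) of a real number $y$. *)

(* Defs.v *)
From HB Require Import structures.
From mathcomp Require Import all_boot all_order all_algebra.
From mathcomp Require Import all_classical all_reals all_analysis.
Set Implicit Arguments.
Unset Strict Implicit.
Unset Printing Implicit Defensive.
Import Order.TTheory GRing.Theory Num.Theory.
Local Open Scope ring_scope.

(* [Num.truncn x] is the floor of x as a natural number when 0 <= x, and 0
   when x < 0, so [iota 1 (Num.truncn x)] lists 1, 2, ..., floor x. *)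
Definition prime_pi (R : realType) (x : R) : nat :=
  count prime (iota 1 (Num.truncn x)).

(* [ln y = 0] for y <= 0, hence [lg y = 0] there as well. *)
Definition lg (R : realType) (x : R) : R := ln x / ln 2.

(* Main.v *)
(* Every n in {1, ..., N} with N < 2^(k+1) is determined by its p-adic
   valuations at the primes p <= N, each of which lies in {0, ..., k}; hence
   N <= (k+1)^pi(N). For k = floor (lg x) and N = floor x one has
   2^k <= N < 2^(k+1), and taking base 2 logarithms of 2^k <= (k+1)^pi(x)
   gives the bound. *)
Require Import Defs.
From HB Require Import structures.
From mathcomp Require Import all_boot all_order all_algebra.
From mathcomp Require Import all_classical all_reals all_analysis.
Import Order.TTheory GRing.Theory Num.Theory.
Local Open Scope ring_scope.

(** For [p] prime, [2 ^ logn p n <= p ^ logn p n <= n]; otherwise [logn p n] is 0. *)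
Lemma logn_le_bound (p n k : nat) :
  (0 < n)%N -> (n < 2 ^ k.+1)%N -> (logn p n <= k)%N.
Proof.
move=> n0 nk; have [pp|/negbTE np] := boolP (prime p); last by rewrite lognE np.
rewrite -ltnS -(ltn_exp2l _ _ (ltnSn 1)); apply: leq_ltn_trans nk.
apply: leq_trans (dvdn_leq n0 (pfactor_dvdnn p n)).
by have [->|l0] := posnP (logn p n); rewrite ?expn0// leq_exp2r// prime_gt1.
Qed.

Lemma leq_exp_count_prime (N k : nat) :
  (N < 2 ^ k.+1)%N -> (N <= k.+1 ^ count prime (iota 1 N))%N.
Proof.
move=> Nk; set ps := [seq p <- iota 1 N | prime p].
rewrite -size_filter -/ps.
(* The ordinal [i] stands for the integer [i.+1]; [inord] loses nothing, since [logn_le_bound] keeps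
   the exponents below [k.+1]. *)
pose f (i : 'I_N) : {ffun 'I_(size ps) -> 'I_k.+1} :=
  [ffun j => inord (logn (nth 0%N ps (nat_of_ord j)) i.+1)].
suff /leq_card : injective f by rewrite card_ffun !card_ord.
move=> i j fij; apply/val_inj/succn_inj/eqn_from_log => // p.
(* A [p] outside [ps] is not prime or exceeds [N], so both valuations vanish. *)
have [pps|pps] := boolP (p \in ps); last first.
  have logn0 (n : 'I_N) : logn p n.+1 = 0%N.
    apply/eqP; rewrite -leqn0 leqNgt logn_gt0 mem_primes /=.
    apply: contra pps => /andP[pp pn].
    rewrite mem_filter pp mem_iota prime_gt0//= add1n ltnS.
    exact: leq_trans (dvdn_leq _ pn) (ltn_ord n).
  by rewrite !logn0.
have ip : (index p ps < size ps)%N by rewrite index_mem.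
have /(congr1 val) := congr1 (fun g : {ffun _ -> 'I_k.+1} => g (Ordinal ip)) fij.
by rewrite !ffunE /= nth_index// !inordK// ltnS logn_le_bound//;
  apply: leq_ltn_trans Nk.
Qed.

Theorem theorem1 (R : realType) (x : R) (hx : 0 < x) :
  (prime_pi x)%:R >=
    (Num.floor (lg x))%:~R / lg ((Num.floor (lg x))%:~R + 1) :> R.
Proof.
have ln2 : 0 < ln 2 :> R by rewrite ln_gt0// ltr1n.
have lnX2 (n : nat) : ln (2 ^+ n) = n%:R * ln 2 :> R.
  by rewrite lnXn// mulr_natl.
have := floor_le (lg x); have := floorD1_gt (lg x).
case: (Num.floor (lg x)) => k; last first.
  (* Here the floor plus 1 is [- k <= 0], so its [ln] is 0 by default and the quotient, a division
     by 0, is 0. *)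
  rewrite NegzE => _ _; rewrite /lg [ln (_ + 1)]ln0 ?mul0r ?invr0 ?mulr0//.
  by rewrite mulrNz -[k.+1]addn1 PoszD intrD opprD subrK oppr_le0 ler0z.
rewrite intrD -!pmulrn natr1 /lg ltr_pdivrMr// ler_pdivlMr// -!lnX2.
rewrite ltr_ln ?ler_ln ?posrE ?exprn_gt0// => xlt xge.
(* [k = 0] is set apart because the denominator [lg 1] is then 0. *)
have [->|k0] := posnP k; first by rewrite mul0r.
have lnk : 0 < ln k.+1%:R :> R by rewrite ln_gt0// ltr1n.
rewrite ler_pdivrMr ?divr_gt0// mulrA ler_pdivlMr// -lnX2 mulr_natl -lnXn//.
rewrite ler_ln ?posrE ?exprn_gt0// -!natrX ler_nat.
have N_ge : (2 ^ k <= Num.truncn x)%N by rewrite truncn_ge_nat ?natrX// ltW.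
have N_lt : (Num.truncn x < 2 ^ k.+1)%N by rewrite truncn_lt_nat ?natrX// ltW.
exact: leq_trans N_ge (leq_exp_count_prime _ _ N_lt).
Qed.
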